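(* Let $E$ be a (Hausdorff, real) locally convex space with an $\omega^\omega$-base whose Hamel basis is uncountable. Then $E$ contains an infinite-dimensional metrizable compact subset.
   Context: A topological vector space $E$ has an $\omega^\omega$-base if there is a neighborhood base $\{U_\alpha:\alpha\in\omega^\omega\}$ at zero such that $U_\beta\subseteq U_\alpha$ whenever $\alpha\le\beta$, where $\omega^\omega$ is the set of all functions $\omega\to\omega$ ordered pointwise ($\alpha\le\beta$ iff $\alpha(n)\le\beta(n)$ for all $n$). A compact set is infinite-dimensional if its linear span is infinite-dimensional (equivalently here, it has infinite topological dimension). *)

(* Defs.v *)
(* mathcomp-analysis (tvs.v: tvsType = locally convex TVS). *)
From HB Require Import structures.
From mathcomp Require Import all_boot all_order all_algebra.
From mathcomp Require Import all_classical all_reals all_analysis.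
Set Implicit Arguments. Unset Strict Implicit. Unset Printing Implicit Defensive.
Import Order.TTheory GRing.Theory Num.Theory.
Local Open Scope classical_set_scope.
Local Open Scope ring_scope.

Section Defs.
Context {R : realType} {E : tvsType R}.

Definition lin_span (S : set E) : set E :=
  [set x | exists n (v : 'I_n -> E) (c : 'I_n -> R),
     (forall i, S (v i)) /\ x = \sum_(i < n) c i *: v i].

Definition lin_indep (S : set E) : Prop :=
  forall n (v : 'I_n -> E) (c : 'I_n -> R),
    injective v -> (forall i, S (v i)) ->
    \sum_(i < n) c i *: v i = 0 -> forall i, c i = 0.

Definition hamel_basis (B : set E) : Prop := lin_indep B /\ lin_span B = setT.

Definition infinite_dimensional (S : set E) : Prop :=
  ~ exists n (v : 'I_n -> E), lin_span S `<=` lin_span (range v).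

Definition omega_omega_base (U : (nat -> nat) -> set E) : Prop :=
  [/\ (forall a, nbhs (0 : E) (U a)),
      (forall N, nbhs (0 : E) N -> exists a, U a `<=` N) &
      (forall a b : nat -> nat, (forall n, (a n <= b n)%N) -> U b `<=` U a)].

Definition has_omega_omega_base : Prop := exists U, omega_omega_base U.

Definition metrizable_set (K : set E) : Prop :=
  exists d : E -> E -> R,
    [/\ (forall x y, K x -> K y -> 0 <= d x y),
        (forall x y, K x -> K y -> (d x y = 0 <-> x = y)),
        (forall x y, K x -> K y -> d x y = d y x),
        (forall x y z, K x -> K y -> K z -> d x z <= d x y + d y z) &
        (forall x, K x -> forall A : set E,
           within K (nbhs x) A <->
           exists2 e : R, 0 < e & forall y, K y -> d x y < e -> A y)].

End Defs.

(* Main.v *)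
(* It suffices to find a linearly independent sequence converging to 0.  For a
   finite sequence [s] let [D s] be the intersection of the [U_b] with [b]
   extending [s].  For every [a] and [x], some [k] has [x] in [(k+1) D(a|k)].
   The countable family of the sets [(k+1) D s] generates a second countable
   topology on [E], so an uncountable Hamel basis has an accumulation point [x]
   in itself, hence distinct elements [u_n] eventually in each [(k+1) D s]
   containing [x].  Taking [s = a|k], the sequence [u_n] is eventually in
   [(k+1) U_a] for some [k] depending on [a]; thus it is bounded, and
   [u_n / (n+1)] converges to 0. *)
Require Import Defs.
From HB Require Import structures.
From mathcomp Require Import all_boot all_order all_algebra.
From mathcomp Require Import all_classical all_reals all_analysis.
Local Open Scope classical_set_scope.
Local Open Scope ring_scope.
Import Order.TTheory GRing.Theory Num.Theory.
Import numFieldNormedType.Exports.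
Set Implicit Arguments.
Unset Strict Implicit.

(** * Selection and counting arguments *)

Lemma injective_choice (T : choiceType) (W : nat -> set T) :
  (forall n, infinite_set (W n)) ->
  exists2 u : nat -> T, injective u & forall n, W n (u n).
Proof.
move=> infW.
have avoid (p : nat * seq T) : exists x, W p.1 x /\ x \notin p.2.
  apply: contrapT => no_x; apply: (infW p.1).
  apply: (@sub_finite_set _ _ [set` p.2]) => // x Wx.
  by apply: contrapT => /negP xp; apply: no_x; exists x.
have [g gP] := choice avoid.
(* [l n] lists the values chosen before stage [n], and [g] picks a point of [W n] outside that
   list. *)
pose l := fix l n := if n is m.+1 then g (m, l m) :: l m else [::].
pose u n := g (n, l n).
have lu m n : (m < n)%N -> u m \in l n.
  elim: n => // n IHn; rewrite ltnS leq_eqVlt => /predU1P[->|/IHn um].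
    by rewrite /= inE eqxx.
  by rewrite /= inE um orbT.
exists u => [m n|n]; last by have [] := gP (n, l n).
have neq i j : (i < j)%N -> u i <> u j.
  by move=> /lu uij ij; have [_] := gP (j, l j); rewrite -/(u j) -ij uij.
move=> umn; case: (ltngtP m n) => // /neq; first by move=> /(_ umn).
by move=> /(_ (esym umn)).
Qed.

(* [x] is an accumulation point of [A] for the second countable topology
   generated by the [P j]. *)
Lemma uncountable_accumulation (T : choiceType) (A : set T)
    (P : nat -> set T) :
  ~ countable A ->
  exists2 x, A x & forall n,
    infinite_set [set y | A y /\ forall j, (j < n)%N -> P j x -> P j y].
Proof.
move=> uncA; apply: contrapT => noacc; apply: uncA.
(* A point that does not accumulate lies in a finite [W s], where [s] records which of the first [n]
   sets [P j] contain it. There are only countably many words [s]. *)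
pose W (s : seq bool) :=
  [set y | A y /\ forall j, (j < size s)%N -> nth false s j -> P j y].
apply: (@sub_countable _ _ _ (\bigcup_(s in [set s | finite_set (W s)]) W s)).
  apply: subset_card_le => x Ax.
  have [n finn] : exists n, finite_set
      [set y | A y /\ forall j, (j < n)%N -> P j x -> P j y].
    apply: contrapT => infx; apply: noacc; exists x => // n finn.
    by apply: infx; exists n.
  exists (mkseq (fun j => `[< P j x >]) n).
    apply: sub_finite_set finn => y [Ay Py]; split=> // j jn Pjx.
    by apply: Py; rewrite ?size_mkseq // nth_mkseq //; apply/asboolP.
  by split=> // j; rewrite size_mkseq => jn; rewrite nth_mkseq // => /asboolP.
by apply: bigcup_countable => [|s]; [exact: countableP|exact: finite_set_countable].
Qed.

(** * Linear algebra of free sequences *)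

Section FreeSequence.
Context {R : realType} {E : tvsType R}.

Definition free_sequence (y : nat -> E) := forall n (c : 'I_n -> R),
  \sum_(i < n) c i *: y i = 0 -> forall i, c i = 0.

Lemma free_sequence_neq0 y n : free_sequence y -> y n <> 0.
Proof.
move=> fy yn0; have : (ord_max == ord_max :> 'I_n.+1)%:R = 0 :> R.
  apply: (fy _ (fun i => (i == ord_max)%:R)).
  rewrite (bigD1 ord_max) //= yn0 scaler0 add0r big1 // => i /negPf ->.
  by rewrite scale0r.
by rewrite eqxx => /eqP; rewrite oner_eq0.
Qed.

Lemma free_sequence_inj y : free_sequence y -> injective y.
Proof.
move=> fy.
have lt_neq i j : (i < j)%N -> y i <> y j.
  move=> ij yij; pose i' : 'I_j.+1 := widen_ord (leqnSn j) (Ordinal ij).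
  have ji' : ord_max != i' by rewrite -val_eqE /= gtn_eqF.
  (* The coefficients 1 at [j] and -1 at [i] give [y j - y i = 0], yet the last one is nonzero. *)
  have : (ord_max == ord_max :> 'I_j.+1)%:R - (ord_max == i')%:R = 0 :> R.
    apply: (fy _ (fun k => (k == ord_max)%:R - (k == i')%:R)).
    rewrite (bigD1 ord_max) //= eqxx (negPf ji') subr0 scale1r.
    rewrite (bigD1 i') 1?eq_sym //= (negPf ji') eqxx sub0r scaleN1r yij.
    rewrite big1 ?addr0 ?subrr // => k /andP[/negPf-> /negPf->].
    by rewrite subrr scale0r.
  by rewrite eqxx (negPf ji') subr0 => /eqP; rewrite oner_eq0.
move=> i j yij; case: (ltngtP i j) => // /lt_neq; first by move=> /(_ yij).
by move=> /(_ (esym yij)).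
Qed.

Lemma lin_span_range n (v : 'I_n -> E) x : lin_span (range v) x ->
  exists a : 'I_n -> R, x = \sum_(i < n) a i *: v i.
Proof.
move=> [m [w [c [wv ->]]]].
have [h hP] : {h : 'I_m -> 'I_n & forall j, v (h j) = w j}.
  by apply: (@choice _ _ (fun j k => v k = w j)) => j; have [k _ <-] := wv j;
      exists k.
exists (fun k => \sum_(j < m | h j == k) c j).
rewrite (partition_big h xpredT) //=; apply: eq_bigr => k _.
by rewrite scaler_suml; apply: eq_bigr => j /eqP <-; rewrite hP.
Qed.

Lemma free_sequence_infinite_dimensional y (K : set E) :
  free_sequence y -> range y `<=` K -> infinite_dimensional K.
Proof.
move=> fy yK [n [v Kv]].
have [a aP] : {a : 'I_n.+1 -> 'I_n -> R &
    forall i : 'I_n.+1, y i = \sum_(k < n) a i k *: v k}.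
  apply: (@choice _ _ (fun (i : 'I_n.+1) b => y i = \sum_(k < n) b k *: v k)) => i.
  apply: lin_span_range; apply: Kv.
  exists 1%N, (fun=> y i), (fun=> 1); split=> [_|]; first exact: yK.
  by rewrite big_ord1 scale1r.
pose A := \matrix_(i, k) a i k.
(* [A] has [n.+1] rows and rank at most [n], so some nonzero row vector kills it; its entries give a
   nontrivial relation among the [y i]. *)
have : kermx A != 0.
  rewrite kermx_eq0 /row_free neq_ltn.
  by rewrite (leq_ltn_trans (rank_leq_col A)).
move=> /rowV0Pn[u /sub_kermxP uA /eqP]; apply; apply/rowP => i; rewrite mxE.
apply: (fy _ (fun i => u 0 i)).
under eq_bigr do rewrite aP scaler_sumr.
rewrite exchange_big big1 //= => k _.
under eq_bigr do rewrite scalerA.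
rewrite -scaler_suml; have /rowP/(_ k) := uA; rewrite !mxE.
by under eq_bigr do rewrite mxE; move=> ->; rewrite scale0r.
Qed.

End FreeSequence.

(** * Compactness and metrizability of a convergent sequence with its limit *)

Lemma nbhs_setC_finite (T : topologicalType) (x : T) (F : set T) :
  hausdorff_space T -> finite_set F -> ~ F x -> nbhs x (~` F).
Proof.
move=> hT finF Fx; apply: open_nbhs_nbhs; split=> //; apply: closed_openC.
by have [h _] := @accessible_finite_set_closed T;
  apply: h finF; exact: hausdorff_accessible.
Qed.

(** If [l] is not a cluster point of the filter, a neighbourhood of [l] misses a member of it. The
    filter then lives on the finitely many terms outside that neighbourhood, and a finite set is
    compact. *)
Lemma cvg_sequence_compact (T : topologicalType) (y : nat -> T) (l : T) :
  y @ \oo --> l -> compact (l |` range y).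
Proof.
move=> yl F PF FK.
have [?|ncl] := pselect (cluster F l); first by exists l; split=> //; left.
have [V [Vl [S FS SV]]] :
    exists V, nbhs l V /\ exists2 S, F S & ~ (S `&` V !=set0).
  apply: contrapT => noV; apply: ncl => S V FS Vl.
  by apply: contrapT => SV; apply: noV; exists V; split=> //; exists S.
have [N _ yV] := yl _ Vl.
have fin : finite_set (y @` `I_N) by exact/finite_image/finite_II.
have FyN : F (y @` `I_N).
  apply: filterS (filterI FS FK) => x [Sx [xl|[n _ ynx]]].
    by case: SV; exists x; split=> //; rewrite xl; exact: nbhs_singleton.
  exists n => //=; rewrite ltnNge; apply/negP => Nn; apply: SV.
  by exists x; split=> //; rewrite -ynx; exact: yV.
have [p [[n _ ynp] clp]] := finite_compact fin PF FyN.
by exists p; split=> //; right; exists n.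
Qed.

Section MetrizableSequence.
Context {R : realType} {E : tvsType R}.

(* The metric is the ultrametric [max (h x) (h z)] for [x != z], with
   [h (y n) = 1 / (n + 1)] and [h l = 0]. *)
Lemma cvg_sequence_metrizable (y : nat -> E) (l : E) : hausdorff_space E ->
  injective y -> (forall n, y n <> l) -> y @ \oo --> l ->
  metrizable_set (l |` range y).
Proof.
move=> hE yinj ynl yl; set K := l |` range y.
have [h hP] : {h : E -> R & forall x,
    (x = l -> h x = 0) /\ forall n, x = y n -> h x = n.+1%:R^-1}.
  apply: (@choice _ _ (fun x r =>
    (x = l -> r = 0) /\ forall n, x = y n -> r = n.+1%:R^-1)) => x.
  have [[n xn]|nx] := pselect (exists n, x = y n).
    exists n.+1%:R^-1; split=> [xl|m]; first by case: (ynl n); rewrite -xn.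
    by rewrite xn => /yinj ->.
  by exists 0; split=> // n xn; case: nx; exists n.
have hl : h l = 0 by apply: (hP l).1.
have hy n : h (y n) = n.+1%:R^-1 by apply: (hP (y n)).2.
have hy_gt0 n : 0 < h (y n) by rewrite hy invr_gt0.
have h_ge0 x : K x -> 0 <= h x.
  by move=> [->|[n _ <-]]; [rewrite hl|exact: ltW].
have h_eq0 x : K x -> h x <= 0 -> x = l.
  by move=> [->//|[n _ <-]]; rewrite leNgt hy_gt0.
pose d x z := if x == z then 0 else Num.max (h x) (h z).
have dC x z : d x z = d z x by rewrite /d eq_sym maxC.
have d_ge0 x z : K x -> 0 <= d x z.
  by rewrite /d => Kx; case: eqP => // _; rewrite le_max h_ge0.
have d_lt x z e : d x z < e -> x = z \/ h x < e /\ h z < e.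
  by rewrite /d; case: eqP => [|_]; [left|rewrite gt_max => /andP; right].
exists d; split=> [x z Kx _|x z Kx Kz|x z _ _|x z t Kx Kz Kt|x Kx A].
- exact: d_ge0.
- split=> [|->]; last by rewrite /d eqxx.
  rewrite /d; case: eqP => // _ /eqP; rewrite eq_le ge_max => /andP[/andP[]].
  by move=> /(h_eq0 _ Kx) -> /(h_eq0 _ Kz) ->.
- exact: dC.
- have [->|/eqP xz] := eqVneq x z; first by rewrite {2}/d eqxx add0r.
  have [->|/eqP zt] := eqVneq z t; first by rewrite {3}/d eqxx addr0.
  have [->|/eqP xt] := eqVneq x t.
    by rewrite {1}/d eqxx addr_ge0 // d_ge0.
  rewrite /d; do 3 case: eqP => // _.
  have := h_ge0 _ Kx; have := h_ge0 _ Kz; have := h_ge0 _ Kt => ht hz hx.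
  by rewrite ge_max; apply/andP; split;
    [apply: ler_wpDr|apply: ler_wpDl]; rewrite le_max ?ht ?hx ?hz ?lexx ?orbT.
split=> [wA|[e e0 eA]].
- case: Kx wA => [->|[n _ <-]] wA; last first.
    (* Every other point of [K] is at distance at least [h (y n)] from [y n], so this ball is a
       singleton. *)
    exists (h (y n)) => // z Kz /d_lt[<-|[]]; last by rewrite ltxx.
    have := nbhs_singleton wA; apply; right; by exists n.
  have [N _ yA] := yl _ wA.
  exists N.+1%:R^-1; first by rewrite invr_gt0.
  move=> z [->|[m _ <-]] => [_|/d_lt].
    by apply: (nbhs_singleton wA); left.
  case=> [/esym/ynl//|[_]]; rewrite hy ltf_pV2 ?posrE // ltr_nat ltnS => Nm.
  by apply: (yA m (ltnW Nm)); right; exists m.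
case: Kx eA => [->|[n _ <-]] eA.
- have [N _ eN] := near_infty_natSinv_lt (PosNum e0).
  have : nbhs l (~` (y @` `I_N)).
    apply: nbhs_setC_finite => //; first exact/finite_image/finite_II.
    by move=> [n _ /ynl].
  apply: filterS => z zN Kz; apply: eA => //.
  case: Kz zN => [-> _|[m _ <-] ymN]; first by rewrite /d eqxx.
  rewrite /d; case: eqP => // _; rewrite gt_max hl e0 hy /=; apply: eN.
  by rewrite /= leqNgt; apply/negP => mN; apply: ymN; exists m.
(* [y n] is isolated in [K]: separating it from [l] leaves finitely many other terms near it, and
   these can be removed. *)
- have [V [W [Vl Wy VW]]] : exists V W, [/\ nbhs l V, nbhs (y n) W &
      forall x, V x -> ~ W x].
    apply: contrapT => noVW; apply: (ynl n); apply/esym/hE => V W Vl Wy.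
    apply: contrapT => VW; apply: noVW; exists V, W; split=> // z Vz Wz.
    by apply: VW; exists z.
  have [N _ yV] := yl _ Vl.
  have : nbhs (y n) (~` (y @` (`I_N `\ n))).
    apply: nbhs_setC_finite => //.
      by apply: finite_image; apply: finite_setD; exact: finite_II.
    by move=> [m [_ mn] /yinj].
  move=> /(filterI Wy); apply: filterS => z [Wz zN] Kz; apply: eA => //.
  case: Kz zN Wz => [-> _ /VW|[m _ <-] ymN Wm].
    by move=> []; exact: nbhs_singleton.
  have [->|mn] := eqVneq m n; first by rewrite /d eqxx.
  case: (ltnP m N) => [mN|Nm]; last by case: (VW (y m)) => //; exact: yV.
  by case: ymN; exists m => //; split=> //; exact/eqP.
Qed.

End MetrizableSequence.

(** * From the base to a free null sequence *)

Section OmegaBase.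
Context {R : realType} {E : tvsType R}.
Implicit Types (U : (nat -> nat) -> set E) (a b : nat -> nat).

(** This is the set [D s]; finite sequences [s] make the family countable. *)
Definition cylinder_meet U (s : seq nat) : set E :=
  [set x | forall b, (forall i, (i < size s)%N -> b i = nth 0%N s i) -> U b x].

Lemma scale_nbhs0 (p : E) (V : set E) : nbhs (0 : E) V ->
  exists e : R, exists2 W : set E, 0 < e /\ nbhs p W &
    forall (t : R) x, `|t| < e -> W x -> V (t *: x).
Proof.
move=> V0; have := @scale_continuous R E (0, p).
rewrite /continuous_at /= scale0r => /(_ _ V0).
move=> [[/= S W] [/nbhs_ballP[e /= e0 eS] Wp] SWV].
exists e, W => // t x te Wx; apply: (SWV (t, x)); split=> //=; apply: eS.
by rewrite /ball /= sub0r normrN.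
Qed.

(* If [x / (k + 1)] avoided every cylinder along [a], the pointwise supremum of
   the witnesses (finite, since the [k]-th one agrees with [a] below [k]) would
   index a neighbourhood of 0 that does not absorb [x]. *)
Lemma cylinder_meet_absorbs U a x : omega_omega_base U ->
  exists k, cylinder_meet U (mkseq a k) (k.+1%:R^-1 *: x).
Proof.
move=> [Unbhs _ Uanti]; apply: contrapT => noabs.
have [b bP] : {b : nat -> nat -> nat & forall k,
    (forall i, (i < k)%N -> b k i = a i) /\ ~ U (b k) (k.+1%:R^-1 *: x)}.
  apply: (@choice _ _ (fun k c => (forall i, (i < k)%N -> c i = a i) /\
    ~ U c (k.+1%:R^-1 *: x))) => k.
  apply: contrapT => nob; apply: noabs; exists k => c.
  rewrite size_mkseq => ca; apply: contrapT => Uc; apply: nob; exists c.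
  by split=> // i ik; rewrite ca // nth_mkseq.
pose c i := maxn (a i) (\max_(k < i.+1) b k i).
have bc k i : (b k i <= c i)%N.
  rewrite /c; case: (ltnP i k) => [ik|ki].
    by rewrite (bP k).1 // leq_maxl.
  rewrite -ltnS in ki; apply: leq_trans (leq_maxr _ _).
  exact: (leq_bigmax (F := fun k : 'I_i.+1 => b k i) (Ordinal ki)).
have [e [W [e0 Wx] eW]] := scale_nbhs0 x (Unbhs c).
have [k _ ke] := near_infty_natSinv_lt (PosNum e0).
apply: (bP k).2; apply: (Uanti _ _ (bc k)); apply: eW; last first.
  exact: nbhs_singleton.
by rewrite ger0_norm // ke /=.
Qed.

Lemma uncountable_free_cvg0 U (B : set E) : omega_omega_base U ->
  lin_indep B -> ~ countable B ->
  exists2 y : nat -> E, free_sequence y & y @ \oo --> (0 : E).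
Proof.
move=> baseU freeB uncB; have [_ Usub _] := baseU.
(* [P] enumerates the sets [(k+1) D s] through codes of pairs [(k, s)]; a number coding no pair gets
   the whole space, which imposes no constraint. *)
pose P j := if unpickle j is Some p then
  [set x | cylinder_meet U p.2 (p.1.+1%:R^-1 *: x)] else [set: E].
have [x Bx xP] := uncountable_accumulation P uncB.
have [u uinj uP] := injective_choice xP.
exists (fun n => n.+1%:R^-1 *: u n).
  move=> n c sum0 i; have : c i * i.+1%:R^-1 = 0.
    apply: (freeB n (u \o val) (fun i => c i * i.+1%:R^-1)).
    - by move=> k m /uinj/val_inj.
    - by move=> k; have [] := uP k.
    - by rewrite -[RHS]sum0; apply: eq_bigr => k _; rewrite scalerA.
  by move/eqP; rewrite mulf_eq0 invr_eq0 pnatr_eq0 orbF => /eqP.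
move=> V V0; have [e [W [e0 W0] eW]] := scale_nbhs0 0 V0.
have [a aW] := Usub _ W0.
have [k Pk] := cylinder_meet_absorbs a x baseU.
pose j := pickle (k, mkseq a k).
suff: \forall n \near \oo, V (n.+1%:R^-1 *: u n) by [].
near=> n.
(* The scalar tends to 0 while, once [n > j], the vector stays in [D(a|k)], hence in [U a] because
   [a] extends its own prefix. *)
have -> : n.+1%:R^-1 *: u n =
    (k.+1%:R / n.+1%:R) *: (k.+1%:R^-1 *: u n) :> E.
  by rewrite scalerA mulrAC divff ?pnatr_eq0 // mul1r.
apply: eW.
  rewrite ger0_norm // ltr_pdivrMr // mulrC -ltr_pdivrMr //.
  apply: (@lt_trans _ _ n%:R); last by rewrite ltr_nat.
  by near: n; exact: nbhs_infty_gtr.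
apply: aW; have [_] := uP n; move=> /(_ j); rewrite /P /j pickleK /=; apply.
- by near: n; exact: nbhs_infty_gt.
- exact: Pk.
- by move=> i; rewrite size_mkseq => ik; rewrite nth_mkseq.
Unshelve. all: by end_near. Qed.

End OmegaBase.

Theorem theorem1p2 (R : realType) (E : tvsType R) :
  hausdorff_space E ->
  @has_omega_omega_base R E ->
  (exists B : set E, hamel_basis B /\ ~ countable B) ->
  exists K : set E, [/\ compact K, metrizable_set K & infinite_dimensional K].
Proof.
move=> hE [U baseU] [B [[freeB _] uncB]].
have [y fy y0] := uncountable_free_cvg0 baseU freeB uncB.
exists (0 |` range y); split.
- exact: cvg_sequence_compact.
- apply: cvg_sequence_metrizable => //; first exact: free_sequence_inj.
  by move=> n; exact: free_sequence_neq0.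
- by apply: free_sequence_infinite_dimensional fy _ => x; right.
Qed.
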